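(* Let $n\ge 2$, let $A,B$ be real symmetric $n\times n$ matrices, $a,b\in\mathbb{R}^n$, $f(x)=\langle Ax,x\rangle+\langle a,x\rangle$, $g(x)=\langle Bx,x\rangle+\langle b,x\rangle$, $F(x)=(f(x),g(x))$ and $F_H(x)=(\langle Ax,x\rangle,\langle Bx,x\rangle)$ for $x\in\mathbb{R}^n$. Assume that ND holds for $A$ and $B$. Then: (a) if $n=2$, then $F_H(\mathbb{R}^2)=\mathbb{R}^2$ or $F(\mathbb{R}^2)$ is convex; (b) if $n\ge 3$, then $F(\mathbb{R}^n)$ is convex.
   Context: ND (non-degenerate) holds for $A$ and $B$ if, for $u\in\mathbb{R}^n$, $\langle Au,u\rangle=0=\langle Bu,u\rangle$ implies $u=0$. $\langle\cdot,\cdot\rangle$ is the standard inner product. *)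

(* Defs.v *)
From mathcomp Require Import all_boot all_order all_algebra.
From mathcomp Require Import classical_sets reals convex.

Set Implicit Arguments.
Unset Strict Implicit.
Unset Printing Implicit Defensive.

Import Order.TTheory GRing.Theory Num.Theory.

Local Open Scope classical_set_scope.
Local Open Scope ring_scope.

Definition inner (R : realType) (n : nat) (u v : 'cV[R]_n) : R :=
  \sum_(i < n) u i 0 * v i 0.

Definition quad (R : realType) (n : nat) (A : 'M[R]_n) (a : 'cV[R]_n)
    (x : 'cV[R]_n) : R :=
  inner (A *m x) x + inner a x.

(* The codomain is written with the regular modules R^o because R itself
   carries no canonical lmodType R structure, which convexity requires. *)
Definition joint (R : realType) (n : nat) (A B : 'M[R]_n) (a b : 'cV[R]_n)
    (x : 'cV[R]_n) : R^o * R^o :=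
  (quad A a x, quad B b x).

Definition joint_hom (R : realType) (n : nat) (A B : 'M[R]_n)
    (x : 'cV[R]_n) : R^o * R^o :=
  (inner (A *m x) x, inner (B *m x) x).

Definition joint_nondegenerate (R : realType) (n : nat) (A B : 'M[R]_n) : Prop :=
  forall u : 'cV[R]_n,
    inner (A *m u) u = 0 -> inner (B *m u) u = 0 -> u = 0.

(* convex_set is stated on the alias convex_lmodType of a module; giving the
   module explicitly fixes the usual segments in R^2. *)
Definition convex2 (R : realType) (S : set (R^o * R^o)) : Prop :=
  convex_set (M := (R^o * R^o)%type) S.

(* Main.v *)
(** The proof is algebraic and only uses square roots and the intermediate value
theorem for polynomials.

Suppose first that [F_H u + F_H v = 0] only for [u = v = 0]. Given distinct [x]
and [y], restrict [F] to a plane through both. There the two binary forms have a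
positive definite combination, so after a linear change of coordinates in the
target [F = (P, Q)] with [P] positive definite in degree 2. Let [T] be a point of
the segment from [F x] to [F y]. On the line through [x] and [y], the equation
[P = T.1] has two roots, and [Q - T.2] has opposite signs at them, because the
restriction of [F] to the line is a parabola (or an affine image of one). The two
roots are joined by an arc of the ellipse [P = T.1], and [Q = T.2] somewhere on
this arc.

Suppose now that [F_H x + F_H y = 0] with [x] and [y] not both zero. After a linear
change of coordinates in the target, [F_H = (M, N)] with [N x = N y = 0] and
[M y < 0 < M x]. If [N] has polar value 0 at [(x, y)], or if [n >= 3], then [x]
and [y] are joined up to scaling inside the cone [N = 0] without meeting 0, so
[M = N = 0] at a nonzero vector, against ND. Hence [n = 2] and [(x, y)] is a
hyperbolic pair for [N], and [F_H = T] can be solved explicitly for every [T]. *)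
Require Import Defs.
From mathcomp Require Import all_boot all_order all_algebra.
From mathcomp Require Import boolp classical_sets reals interval_inference convex.
From mathcomp Require Import ring lra.

Import Order.TTheory GRing.Theory Num.Theory.
Local Open Scope classical_set_scope.
Local Open Scope ring_scope.

(** * Interpolation for two binary quadratics, one positive definite *)

Lemma poly_root01 {R : rcfType} (p : {poly R}) :
  p.[0] * p.[1] <= 0 -> exists s : R, p.[s] = 0.
Proof.
move=> h.
have aux (q : {poly R}) : q.[0] <= 0 -> q.[0] * q.[1] <= 0 ->
    exists s, q.[s] = 0.
  move=> q0 q01; have [q1|q1] := leP 0 q.[1].
    have [|s _ /rootP] := @poly_ivt R q 0 1 ler01; first by rewrite q0.
    by exists s.
  (* Here [q.[1] < 0], so the product condition forces [q.[0] = 0]. *)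
  exists 0; nra.
have [p0|p0] := leP p.[0] 0; first exact: aux.
have [||s] := aux (- p); rewrite ?hornerN; [lra|lra|].
by exists s; lra.
Qed.

Definition horner_expand :=
  (hornerD, hornerN, hornerZ, hornerM, hornerMn, horner_exp, hornerX, hornerC).

Definition bform {R : rcfType} (p11 p12 p22 X Y : R) : R :=
  p11 * X ^+ 2 + p12 * X * Y *+ 2 + p22 * Y ^+ 2.

Definition bform_pos {R : rcfType} (p11 p12 p22 : R) : Prop :=
  forall X Y, (X, Y) <> (0, 0) -> 0 < bform p11 p12 p22 X Y.

(** There is no constant term: values are taken relative to the base point, one end of the segment;
    the other end is at [(1, 0)]. *)
Definition bquad {R : rcfType} (p11 p12 p22 p1 p2 X Y : R) : R :=
  bform p11 p12 p22 X Y + p1 * X + p2 * Y.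

Lemma bquad_pos_interp {R : rcfType}
    {p11 p12 p22 : R} (p1 p2 q11 q12 q22 q1 q2 : R) {t : R} :
  bform_pos p11 p12 p22 -> 0 < t < 1 ->
  exists X Y,
    bquad p11 p12 p22 p1 p2 X Y = t * bquad p11 p12 p22 p1 p2 1 0 /\
    bquad q11 q12 q22 q1 q2 X Y = t * bquad q11 q12 q22 q1 q2 1 0.
Proof.
move=> pos /andP[t0 t1].
have p11_gt0 : 0 < p11.
  have /pos : (1 : R, 0 : R) <> (0, 0) by case=> /eqP; rewrite oner_eq0.
  by rewrite /bform; lra.
(* Discriminant of [P = T.1] on the axis [Y = 0], that is of [p11 X^2 + p1 X = t (p11 + p1)]; its
   roots are [a1] and [a2]. *)
pose disc := p1 ^+ 2 + 4 * t * p11 * (p11 + p1).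
have disc_gt0 : 0 < disc.
  have -> : disc = (p1 + 2 * t * p11) ^+ 2 + 4 * (t * (1 - t)) * p11 ^+ 2.
    by rewrite /disc; ring.
  rewrite ltr_wpDl ?sqr_ge0// !mulr_gt0 ?exprn_gt0//; lra.
pose s := Num.sqrt disc.
have s_gt0 : 0 < s by rewrite sqrtr_gt0.
have sE : s ^+ 2 = disc by rewrite sqr_sqrtr// ltW.
have p11_neq0 : p11 != 0 by rewrite gt_eqF.
have s_neq0 : s != 0 by rewrite gt_eqF.
pose a1 := (- p1 - s) / (2 * p11).
pose a2 := (- p1 + s) / (2 * p11).
have a_sum : p11 * (a1 + a2) = - p1 by rewrite /a1 /a2; field.
have a_dif : p11 * (a2 - a1) = s by rewrite /a1 /a2; field.
have a_mul : p11 * (a1 * a2) = - t * (p11 + p1).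
  have -> : p11 * (a1 * a2) = (p1 ^+ 2 - s ^+ 2) / (4 * p11).
    by rewrite /a1 /a2; field.
  by rewrite sE /disc; field.
(* So [t] separates the two roots; the opposite signs of [Q - T.2] come from this. *)
have a_mult : (a1 - t) * (a2 - t) = - (t * (1 - t)).
  apply: (mulfI p11_neq0).
  have -> : p11 * ((a1 - t) * (a2 - t)) =
    p11 * (a1 * a2) - t * (p11 * (a1 + a2)) + p11 * t ^+ 2 by ring.
  by rewrite a_mul a_sum; ring.
clearbody a1 a2; clear sE; clearbody s.
(* The lines through [(a1, 0)] parametrize the conic [P = const]: [e] gives
   the tangent direction, and [u = 1] the line leading to [(a2, 0)]. *)
have [e eE] : exists e, s * e = 2 * p12 * a1 + p2.
  by exists ((2 * p12 * a1 + p2) / s); rewrite mulrC mulfVK.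
pose v1 : {poly R} := 'X + e *: (1%:P - 'X).
pose v2 : {poly R} := 1%:P - 'X.
pose Pv : {poly R} := p11 *: v1 ^+ 2 + (p12 *: (v1 * v2)) *+ 2 + p22 *: v2 ^+ 2.
pose Qv : {poly R} := q11 *: v1 ^+ 2 + (q12 *: (v1 * v2)) *+ 2 + q22 *: v2 ^+ 2.
pose Lv : {poly R} := (2 * q11 * a1 + q1) *: v1 + (2 * q12 * a1 + q2) *: v2.
(* [c] is [Q - T.2] at [(a1, 0)]. The line with direction [v = (v1, v2)] meets the conic again at
   [(a1, 0) + (s u / Pv) v], and [H] is [Q - T.2] there, multiplied by [Pv ^+ 2]. *)
pose c := q11 * a1 ^+ 2 + q1 * a1 - t * (q11 + q1).
pose H : {poly R} := c *: Pv ^+ 2 + s *: ('X * Pv * Lv)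
  + s ^+ 2 *: ('X ^+ 2 * Qv).
pose w1 u := u + e * (1 - u); pose w2 (u : R) := 1 - u.
have PvE u : Pv.[u] = bform p11 p12 p22 (w1 u) (w2 u).
  by rewrite /Pv /v1 /v2 !horner_expand /bform /w1 /w2; ring.
have QvE u : Qv.[u] = bform q11 q12 q22 (w1 u) (w2 u).
  by rewrite /Qv /v1 /v2 !horner_expand /bform /w1 /w2; ring.
have LvE u : Lv.[u] = (2 * q11 * a1 + q1) * w1 u + (2 * q12 * a1 + q2) * w2 u.
  by rewrite /Lv /v1 /v2 !horner_expand /w1 /w2; ring.
have HE u : H.[u] = c * Pv.[u] ^+ 2 + s * (u * Pv.[u] * Lv.[u]) +
    s ^+ 2 * (u ^+ 2 * Qv.[u]).
  by rewrite {}/H; clearbody Pv Lv Qv; rewrite !horner_expand.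
clearbody Pv Lv Qv H.
have [|u Hu0] := poly_root01 H.
  (* On the axis, [Q - T.2] at a root [ai] equals [(ai - t) (q1 + q11 (a1 + a2))]. *)
  have -> : H.[0] = (a1 - t) * (q1 + q11 * (a1 + a2)) * Pv.[0] ^+ 2.
    have -> : (a1 - t) * (q1 + q11 * (a1 + a2)) = c.
      rewrite /c.
      have -> : (a1 - t) * (q1 + q11 * (a1 + a2)) =
        (a1 - t) * (q1 + q11 * (a1 + t)) + q11 * ((a1 - t) * (a2 - t)) by ring.
      by rewrite a_mult; ring.
    by rewrite HE; ring.
  have -> : H.[1] = (a2 - t) * (q1 + q11 * (a1 + a2)) * p11 ^+ 2.
    have -> : (a2 - t) * (q1 + q11 * (a1 + a2)) =
        (a2 - t) * (q1 + q11 * (a2 + t)) + q11 * ((a1 - t) * (a2 - t)) by ring.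
    rewrite a_mult HE PvE LvE QvE /w1 /w2 subrr mulr0 addr0.
    by rewrite /bform /c -a_dif; ring.
  set k := q1 + _; set z := Pv.[0].
  have -> : (a1 - t) * k * z ^+ 2 * ((a2 - t) * k * p11 ^+ 2) =
     - (t * (1 - t) * (k * z * p11) ^+ 2).
    by rewrite -[t * (1 - t)]opprK -a_mult; ring.
  by rewrite oppr_le0 mulr_ge0 ?sqr_ge0// mulr_ge0; lra.
have w_neq0 : (w1 u, w2 u) <> (0, 0).
  rewrite /w1 /w2 => -[h1 h2]; have u1 : u = 1 by lra.
  by move/eqP: h1; rewrite u1 subrr mulr0 addr0 oner_eq0.
have := pos _ _ w_neq0; rewrite -PvE => Pu.
have Pu0 : Pv.[u] != 0 by rewrite gt_eqF.
pose r := s * u / Pv.[u].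
have rPv : r * Pv.[u] = s * u by rewrite /r mulfVK.
have ew : (2 * p11 * a1 + p1) * w1 u + (2 * p12 * a1 + p2) * w2 u = - s * u.
  have -> : 2 * p11 * a1 + p1 = - s by lra.
  rewrite -eE.
  by rewrite /w1 /w2; ring.
clearbody r w1 w2.
have Q_end : Pv.[u] ^+ 2 * (bquad q11 q12 q22 q1 q2 (a1 + r * w1 u) (r * w2 u) -
    t * bquad q11 q12 q22 q1 q2 1 0) = 0.
  transitivity (c * Pv.[u] ^+ 2 + (r * Pv.[u]) * Pv.[u] * Lv.[u] +
      (r * Pv.[u]) ^+ 2 * Qv.[u]).
    rewrite LvE QvE.
    by rewrite /bquad /bform /c; ring.
  by rewrite rPv -Hu0 HE; ring.
have P_end : bquad p11 p12 p22 p1 p2 (a1 + r * w1 u) (r * w2 u) =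
    t * bquad p11 p12 p22 p1 p2 1 0.
  transitivity ((p11 * a1 ^+ 2 + p1 * a1) +
    r * ((2 * p11 * a1 + p1) * w1 u + (2 * p12 * a1 + p2) * w2 u) +
    r * (r * bform p11 p12 p22 (w1 u) (w2 u))).
    by rewrite /bquad /bform; ring.
  rewrite ew -PvE rPv.
  have -> : p11 * a1 ^+ 2 + p1 * a1 = t * (p11 + p1).
    have -> : p11 * a1 ^+ 2 = a1 * (p11 * (a1 + a2)) - p11 * (a1 * a2) by ring.
    by rewrite a_mul a_sum; ring.
  by rewrite /bquad /bform; ring.
exists (a1 + r * w1 u), (r * w2 u); split=> //.
by move/eqP: Q_end; rewrite mulf_eq0 expf_eq0/= (negPf Pu0) subr_eq0 => /eqP.
Qed.

(** * Positive definite combinations of two binary forms *)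

Lemma bformZ {R : rcfType} (a h b k X Y : R) :
  bform a h b (k * X) (k * Y) = k ^+ 2 * bform a h b X Y.
Proof. by rewrite /bform; ring. Qed.

Lemma sqr_norm_gt0 {R : rcfType} {X Y : R} :
  (X, Y) <> (0, 0) -> 0 < X ^+ 2 + Y ^+ 2.
Proof.
move=> XY; rewrite lt0r paddr_eq0 ?sqr_ge0// addr_ge0 ?sqr_ge0// andbT.
by apply/negP => /andP[]; rewrite !sqrf_eq0 => /eqP X0 /eqP Y0; rewrite X0 Y0 in XY.
Qed.

Lemma binary_form_root {R : rcfType} {a b c : R} : 0 <= b ^+ 2 - 4 * a * c ->
  exists x y, (x, y) <> (0, 0) /\ a * x ^+ 2 + b * x * y + c * y ^+ 2 = 0.
Proof.
move=> D; have [a0|a0] := eqVneq a 0.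
  exists 1, 0; split; last by rewrite a0; ring.
  by case=> /eqP; rewrite oner_eq0.
pose s := Num.sqrt (b ^+ 2 - 4 * a * c).
exists (- b + s), (2 * a); split.
  by case=> _ /eqP; rewrite mulf_eq0 (negPf a0) pnatr_eq0.
have sE : s ^+ 2 = b ^+ 2 - 4 * a * c by rewrite sqr_sqrtr.
have -> : a * (- b + s) ^+ 2 + b * (- b + s) * (2 * a) + c * (2 * a) ^+ 2 =
  a * (s ^+ 2 - (b ^+ 2 - 4 * a * c)) by ring.
by rewrite sE subrr mulr0.
Qed.

Definition no_opposite {R : rcfType} (p1 q1 r1 p2 q2 r2 : R) : Prop :=
  forall X Y X' Y',
    bform p1 q1 r1 X Y + bform p1 q1 r1 X' Y' = 0 ->
    bform p2 q2 r2 X Y + bform p2 q2 r2 X' Y' = 0 ->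
    (X, Y) = (0, 0) /\ (X', Y') = (0, 0).

Lemma definite_combination {R : rcfType} {p1 q1 r1 p2 q2 r2 : R} :
  no_opposite p1 q1 r1 p2 q2 r2 ->
  exists l m, bform_pos (l * p1 + m * p2) (l * q1 + m * q2) (l * r1 + m * r2).
Proof.
move=> no_opp.
(* [J] is the Jacobian form of the pair: at a root, the two polar linear
   forms are dependent, so both forms diagonalize in a common basis; if it has
   no root, the vector [(- jb, 2 * ja)] is mapped opposite to [(1, 0)]. *)
pose ja := p1 * q2 - p2 * q1; pose jb := p1 * r2 - p2 * r1.
pose jc := q1 * r2 - q2 * r1.
have [D|/binary_form_root[x [y [xy0 J0]]]] := ltP (jb ^+ 2 - 4 * ja * jc) 0.
  have s_sqr : Num.sqrt (4 * ja * jc - jb ^+ 2) ^+ 2 = 4 * ja * jc - jb ^+ 2.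
    by rewrite sqr_sqrtr//; lra.
  have s_gt0 : 0 < Num.sqrt (4 * ja * jc - jb ^+ 2) by rewrite sqrtr_gt0; lra.
  move: (Num.sqrt _) s_sqr s_gt0 => s s_sqr s_gt0.
  have [||[s0] _] := no_opp s 0 (- jb) (2 * ja).
  - transitivity ((s ^+ 2 - (4 * ja * jc - jb ^+ 2)) * p1).
      by rewrite /bform /ja /jb /jc; ring.
    by rewrite s_sqr subrr mul0r.
  - transitivity ((s ^+ 2 - (4 * ja * jc - jb ^+ 2)) * p2).
      by rewrite /bform /ja /jb /jc; ring.
    by rewrite s_sqr subrr mul0r.
  by move: s_gt0; rewrite s0 ltxx.
pose P1 := bform p1 q1 r1 x y; pose P2 := bform p2 q2 r2 x y.
(* [S1] and [S2] are the polar values of the two forms at [(x, y)] and [(- y, x)]. *)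
pose S1 := q1 * (x ^+ 2 - y ^+ 2) + (r1 - p1) * x * y.
pose S2 := q2 * (x ^+ 2 - y ^+ 2) + (r2 - p2) * x * y.
have P_gt0 : 0 < P1 ^+ 2 + P2 ^+ 2.
  apply: sqr_norm_gt0 => -[P10 P20]; apply: xy0.
  have [||//] := no_opp x y 0 0; rewrite -/P1 -/P2 ?P10 ?P20 /bform; ring.
have P_neq0 : P1 ^+ 2 + P2 ^+ 2 != 0 by rewrite gt_eqF.
have PS : P1 * S2 - P2 * S1 = 0.
  transitivity ((x ^+ 2 + y ^+ 2) *
      (ja * x ^+ 2 + jb * x * y + jc * y ^+ 2)); last by rewrite J0 mulr0.
  by rewrite /P1 /P2 /S1 /S2 /bform /ja /jb /jc; ring.
have [k [S1E S2E]] : exists k, S1 = k * P1 /\ S2 = k * P2.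
  exists ((P1 * S1 + P2 * S2) / (P1 ^+ 2 + P2 ^+ 2)).
  by split; apply: (mulfI P_neq0); rewrite mulrA [_ * (_ / _)]mulrC mulfVK //;
    apply/eqP; rewrite -subr_eq0; apply/eqP;
    [transitivity (- P2 * (P1 * S2 - P2 * S1)); first ring
    |transitivity (P1 * (P1 * S2 - P2 * S1)); first ring];
    rewrite PS mulr0.
(* Subtracting [k (x, y)] from [(- y, x)] makes it polar to [(x, y)] for both forms. The basis has
   determinant [x^2 + y^2]. *)
pose x' := - y - k * x; pose y' := x - k * y.
pose R1 := bform p1 q1 r1 x' y'; pose R2 := bform p2 q2 r2 x' y'.
have n_gt0 := sqr_norm_gt0 xy0.
have diag1 X Y : (x ^+ 2 + y ^+ 2) ^+ 2 * bform p1 q1 r1 X Y =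
    (X * y' - Y * x') ^+ 2 * P1 + (x * Y - y * X) ^+ 2 * R1.
  transitivity ((X * y' - Y * x') ^+ 2 * P1 + (x * Y - y * X) ^+ 2 * R1 +
    2 * (X * y' - Y * x') * (x * Y - y * X) * (S1 - k * P1)).
    by rewrite /P1 /R1 /S1 /bform /x' /y'; ring.
  by rewrite S1E subrr mulr0 addr0.
have diag2 X Y : (x ^+ 2 + y ^+ 2) ^+ 2 * bform p2 q2 r2 X Y =
    (X * y' - Y * x') ^+ 2 * P2 + (x * Y - y * X) ^+ 2 * R2.
  transitivity ((X * y' - Y * x') ^+ 2 * P2 + (x * Y - y * X) ^+ 2 * R2 +
    2 * (X * y' - Y * x') * (x * Y - y * X) * (S2 - k * P2)).
    by rewrite /P2 /R2 /S2 /bform /x' /y'; ring.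
  by rewrite S2E subrr mulr0 addr0.
have [l [m [lP lR]]] : exists l m, 0 < l * P1 + m * P2 /\ 0 < l * R1 + m * R2.
  (* If [(P1, P2)] and [(R1, R2)] are independent, Cramer's rule gives a functional equal to 1 on
     both. If they are parallel with positive inner product, [(P1, P2)] itself serves; otherwise
     scaling makes their sum 0, against [no_opp]. *)
  have [D0|D0] := eqVneq (P1 * R2 - P2 * R1) 0; last first.
    exists ((R2 - P2) / (P1 * R2 - P2 * R1)), ((P1 - R1) / (P1 * R2 - P2 * R1)).
    clearbody P1 P2 R1 R2.
    have -> : (R2 - P2) / (P1 * R2 - P2 * R1) * P1 +
      (P1 - R1) / (P1 * R2 - P2 * R1) * P2 = 1 by field.
    have -> : (R2 - P2) / (P1 * R2 - P2 * R1) * R1 +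
      (P1 - R1) / (P1 * R2 - P2 * R1) * R2 = 1 by field.
    by rewrite ltr01.
  have [PR|PR] := ltP 0 (P1 * R1 + P2 * R2).
    by exists P1, P2; split=> //; lra.
  have s_sqr : Num.sqrt (- (P1 * R1 + P2 * R2)) ^+ 2 = - (P1 * R1 + P2 * R2).
    by rewrite sqr_sqrtr//; lra.
  have s'_gt0 : 0 < Num.sqrt (P1 ^+ 2 + P2 ^+ 2) by rewrite sqrtr_gt0.
  have s'_sqr := sqr_sqrtr (ltW P_gt0).
  move: (Num.sqrt _) (Num.sqrt _) s_sqr s'_sqr s'_gt0 => s' s s_sqr s'_sqr s'_gt0.
  have [||_ [x0 y0]] := no_opp (s * x) (s * y) (s' * x') (s' * y').
  - rewrite !bformZ -/P1 -/R1 s_sqr s'_sqr.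
    transitivity (- P2 * (P1 * R2 - P2 * R1)); first by clearbody R1 R2; ring.
    by rewrite D0 mulr0.
  - rewrite !bformZ -/P2 -/R2 s_sqr s'_sqr.
    transitivity (P1 * (P1 * R2 - P2 * R1)); first by clearbody R1 R2; ring.
    by rewrite D0 mulr0.
  have : s' * (x ^+ 2 + y ^+ 2) = 0.
    by transitivity (x * (s' * y') - y * (s' * x'));
      [rewrite /x' /y'; ring | rewrite x0 y0; ring].
  by move/eqP; rewrite mulf_eq0 !gt_eqF.
exists l, m => X Y XY0.
rewrite -(pmulr_rgt0 _ (exprn_gt0 2 n_gt0)).
have -> : (x ^+ 2 + y ^+ 2) ^+ 2 *
    bform (l * p1 + m * p2) (l * q1 + m * q2) (l * r1 + m * r2) X Y =
  (X * y' - Y * x') ^+ 2 * (l * P1 + m * P2) +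
  (x * Y - y * X) ^+ 2 * (l * R1 + m * R2).
  transitivity (l * ((x ^+ 2 + y ^+ 2) ^+ 2 * bform p1 q1 r1 X Y) +
    m * ((x ^+ 2 + y ^+ 2) ^+ 2 * bform p2 q2 r2 X Y)).
    by rewrite /bform; ring.
  by rewrite diag1 diag2; clearbody P1 P2 R1 R2; ring.
have [b0|b0] := eqVneq (x * Y - y * X) 0; last first.
  apply: ltr_wpDl; [by rewrite mulr_ge0 ?sqr_ge0// ltW |
    by rewrite mulr_gt0// exprn_even_gt0].
have [a0|a0] := eqVneq (X * y' - Y * x') 0; last first.
  apply: ltr_pwDl; [by rewrite mulr_gt0// exprn_even_gt0 |
    by rewrite mulr_ge0 ?sqr_ge0// ltW].
have nX : (x ^+ 2 + y ^+ 2) * X = 0.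
  transitivity (x * (X * y' - Y * x') + x' * (x * Y - y * X));
    [rewrite /x' /y'; ring | by rewrite a0 b0 !mulr0 addr0].
have nY : (x ^+ 2 + y ^+ 2) * Y = 0.
  transitivity (y * (X * y' - Y * x') + y' * (x * Y - y * X));
    [rewrite /x' /y'; ring | by rewrite a0 b0 !mulr0 addr0].
exfalso; apply: XY0.
move/eqP: nX; move/eqP: nY; rewrite !mulf_eq0 gt_eqF//=.
by move=> /eqP-> /eqP->.
Qed.

(** The similarity [(u, v) -> (l u + m v, l v - m u)] of the target makes the first form positive
    definite; it has determinant [l^2 + m^2] and is undone at the end. *)
Lemma bquad_interp {R : rcfType}
    {p11 p12 p22 q11 q12 q22 : R} (p1 p2 q1 q2 : R) {t : R} :
  no_opposite p11 p12 p22 q11 q12 q22 -> 0 < t < 1 ->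
  exists X Y,
    bquad p11 p12 p22 p1 p2 X Y = t * bquad p11 p12 p22 p1 p2 1 0 /\
    bquad q11 q12 q22 q1 q2 X Y = t * bquad q11 q12 q22 q1 q2 1 0.
Proof.
move=> /definite_combination[l [m pos]] t01.
have lm_gt0 : 0 < l ^+ 2 + m ^+ 2.
  apply: sqr_norm_gt0 => -[l0 m0].
  have /pos : (1 : R, 0 : R) <> (0, 0) by case=> /eqP; rewrite oner_eq0.
  by rewrite l0 m0 /bform => h; lra.
have lm_neq0 : l ^+ 2 + m ^+ 2 != 0 by rewrite gt_eqF.
have [X [Y [eP eQ]]] := bquad_pos_interp (l * p1 + m * q1) (l * p2 + m * q2)
  (l * q11 - m * p11) (l * q12 - m * p12) (l * q22 - m * p22)
  (l * q1 - m * p1) (l * q2 - m * p2) pos t01.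
exists X, Y; split; apply: (mulfI lm_neq0).
  by move: eP eQ; rewrite /bquad /bform => eP eQ;
    have := congr2 (fun u v => l * u - m * v) eP eQ => /= e; lra.
by move: eP eQ; rewrite /bquad /bform => eP eQ;
    have := congr2 (fun u v => m * u + l * v) eP eQ => /= e; lra.
Qed.

(** * Inner products and restriction to planes *)

Lemma innerE {R : realType} {n} (u v : 'cV[R]_n) : inner u v = (u^T *m v) 0 0.
Proof. by rewrite mxE; apply: eq_bigr => i _; rewrite mxE. Qed.

Lemma innerC {R : realType} {n} (u v : 'cV[R]_n) : inner u v = inner v u.
Proof. by apply: eq_bigr => i _; rewrite mulrC. Qed.

Lemma innerDr {R : realType} {n} (u v w : 'cV[R]_n) :
  inner u (v + w) = inner u v + inner u w.
Proof. by rewrite !innerE mulmxDr mxE. Qed.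

Lemma innerZr {R : realType} {n} (u v : 'cV[R]_n) k :
  inner u (k *: v) = k * inner u v.
Proof. by rewrite !innerE -scalemxAr mxE. Qed.

Lemma innerDl {R : realType} {n} (u v w : 'cV[R]_n) :
  inner (v + w) u = inner v u + inner w u.
Proof. by rewrite innerC innerDr !(innerC u). Qed.

Lemma innerZl {R : realType} {n} (u v : 'cV[R]_n) k :
  inner (k *: v) u = k * inner v u.
Proof. by rewrite innerC innerZr innerC. Qed.

Lemma inner_mxC {R : realType} {n} {A : 'M[R]_n} (u v : 'cV[R]_n) : A^T = A ->
  inner (A *m u) v = inner (A *m v) u.
Proof. by move=> hA; rewrite (innerC _ u) !innerE trmx_mul hA mulmxA. Qed.

Lemma inner_self_eq0 {R : realType} {n} (u : 'cV[R]_n) : inner u u = 0 -> u = 0.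
Proof.
move/eqP; rewrite psumr_eq0 => [|i _]; last by rewrite -expr2 sqr_ge0.
move=> /allP h; apply/colP => i; rewrite mxE; apply/eqP.
by move: (h i (mem_index_enum i)); rewrite -expr2 sqrf_eq0.
Qed.

Lemma inner0r {R : realType} {n} (u : 'cV[R]_n) : inner u 0 = 0.
Proof. by rewrite innerE mulmx0 mxE. Qed.

Lemma quad_plane {R : realType} {n} (A : 'M[R]_n) (a x d w : 'cV[R]_n) X Y :
  A^T = A ->
  quad A a (x + X *: d + Y *: w) = quad A a x +
    bquad (inner (A *m d) d) (inner (A *m d) w) (inner (A *m w) w)
      (2 * inner (A *m x) d + inner a d) (2 * inner (A *m x) w + inner a w) X Y.
Proof.
move=> hA; rewrite /quad /bquad /bform !(mulmxDr, innerDl, innerDr).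
rewrite -!scalemxAr !(innerZl, innerZr).
by rewrite (inner_mxC d x hA) (inner_mxC w x hA) (inner_mxC w d hA); ring.
Qed.

Lemma inner_mx_plane {R : realType} {n} (A : 'M[R]_n) (d w : 'cV[R]_n) X Y :
  A^T = A ->
  inner (A *m (X *: d + Y *: w)) (X *: d + Y *: w) =
    bform (inner (A *m d) d) (inner (A *m d) w) (inner (A *m w) w) X Y.
Proof.
move=> hA; rewrite /bform !(mulmxDr, innerDl, innerDr).
rewrite -!scalemxAr !(innerZl, innerZr).
by rewrite (inner_mxC w d hA); ring.
Qed.

Lemma exists_orthogonal {R : realType} {n k} (M : 'M[R]_(n, k)) : (k < n)%N ->
  exists2 w : 'cV[R]_n, w != 0 & w^T *m M = 0.
Proof.
move=> kn; have : kermx M != 0.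
  rewrite kermx_eq0 /row_free; apply/eqP => h.
  by have := rank_leq_col M; rewrite h leqNgt kn.
case/rowV0Pn => v /sub_kermxP vM v0; exists v^T; last by rewrite trmxK.
by rewrite -trmx0 (inj_eq trmx_inj).
Qed.

(** * Convexity in the absence of opposite values *)

Definition no_opposite_mx {R : realType} {n} (A B : 'M[R]_n) : Prop :=
  forall u v : 'cV[R]_n,
    inner (A *m u) u + inner (A *m v) v = 0 ->
    inner (B *m u) u + inner (B *m v) v = 0 -> u = 0 /\ v = 0.

Lemma joint_range_convex {R : realType} {n} {A B : 'M[R]_n} (a b : 'cV[R]_n) :
  (2 <= n)%N -> A^T = A -> B^T = B -> no_opposite_mx A B ->
  convex2 (range (joint A B a b)).
Proof.
move=> hn hA hB no_opp; apply/convex_setW => _ _ /set_mem[x _ <-] /set_mem[y _ <-].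
move=> t t0 t1; have [->|xy] := eqVneq x y.
  by rewrite convmm; apply/mem_set; exists y.
pose d := y - x; have d0 : d != 0 by rewrite subr_eq0 eq_sym.
have [w w0 wd] := exists_orthogonal d hn.
have dw : inner w d = 0 by rewrite innerE wd mxE.
have dd : inner d d != 0 by apply: contra d0 => /eqP /inner_self_eq0 ->.
have indep X Y : X *: d + Y *: w = 0 -> (X, Y) = (0, 0).
  move=> XY; have /eqP := congr1 (inner d) XY.
  rewrite inner0r innerDr !innerZr (innerC d w) dw mulr0 addr0 mulf_eq0.
  rewrite (negPf dd) orbF => /eqP X0; congr (_, _) => //.
  by move/eqP: XY; rewrite X0 scale0r add0r scaler_eq0 (negPf w0) orbF => /eqP.
(* In the convex combination [t] is the weight of [x], so the parameter running from [x] to [y] is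
   [1 - t]. *)
have t01 : 0 < 1 - t%:num < 1 by apply/andP; split; lra.
have no_opp2 : no_opposite
    (inner (A *m d) d) (inner (A *m d) w) (inner (A *m w) w)
    (inner (B *m d) d) (inner (B *m d) w) (inner (B *m w) w).
  move=> X Y X' Y'; rewrite -!inner_mx_plane// => hf hg.
  by have [/indep-> /indep->] := no_opp _ _ hf hg.
have [X [Y [eP eQ]]] := bquad_interp
  (2 * inner (A *m x) d + inner a d) (2 * inner (A *m x) w + inner a w)
  (2 * inner (B *m x) d + inner b d) (2 * inner (B *m x) w + inner b w)
  no_opp2 t01.
have yE : y = x + 1 *: d + 0 *: w.
  by rewrite scale1r scale0r addr0 /d addrC subrK.
apply/mem_set; exists (x + X *: d + Y *: w) => //.
rewrite [in RHS]yE /joint !quad_plane// eP eQ.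
set u := bquad _ _ _ _ _ 1 0; set v := bquad _ _ _ _ _ 1 0.
congr (_, _).
  by transitivity (t%:num * quad A a x + (1 - t%:num) * (quad A a x + u)); [ring|].
by transitivity (t%:num * quad B b x + (1 - t%:num) * (quad B b x + v)); [ring|].
Qed.

(** * Opposite values and common zeros *)

(** [N] vanishes on the whole span of [x] and [y], and [M] is indefinite there. *)
Lemma polar_zero_common_zero {R : realType} {n} {M N : 'M[R]_n} {x y : 'cV[R]_n} :
  M^T = M -> N^T = N ->
  0 < inner (M *m x) x -> inner (M *m y) y < 0 ->
  inner (N *m x) x = 0 -> inner (N *m y) y = 0 -> inner (N *m x) y = 0 ->
  exists u, [/\ u != 0, inner (M *m u) u = 0 & inner (N *m u) u = 0].
Proof.
move=> hM hN Mx My Nx Ny Nxy.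
have [X [Y [XY0 fXY]]] : exists X Y, (X, Y) <> (0, 0) /\
    inner (M *m x) x * X ^+ 2 + 2 * inner (M *m x) y * X * Y +
    inner (M *m y) y * Y ^+ 2 = 0.
  apply: binary_form_root; have := sqr_ge0 (2 * inner (M *m x) y).
  by have := mulr_gt0 Mx (_ : 0 < - inner (M *m y) y); rewrite oppr_gt0; nra.
exists (X *: x + Y *: y); split.
- apply/eqP => u0; apply: XY0.
  (* From [X x = - Y y]; the left side is nonnegative and the right side nonpositive, so both
     vanish. *)
  have h : inner (M *m x) x * X ^+ 2 = inner (M *m y) y * Y ^+ 2.
    have uy : X *: x = - Y *: y.
      by rewrite scaleNr; apply/eqP; rewrite -addr_eq0; apply/eqP.
    have := erefl (inner (M *m (X *: x)) (X *: x)); rewrite {3 4}uy.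
    by rewrite -!scalemxAr !(innerZl, innerZr) => h; lra.
  have X0 : inner (M *m x) x * X ^+ 2 = 0.
    apply/eqP; rewrite eq_le; apply/andP; split.
      by rewrite h mulr_le0_ge0 ?sqr_ge0 ?ltW.
    by rewrite mulr_ge0 ?sqr_ge0 ?ltW.
  have Y0 : inner (M *m y) y * Y ^+ 2 = 0 by rewrite -h.
  move/eqP: X0; rewrite mulf_eq0 (gt_eqF Mx) /= sqrf_eq0 => /eqP->.
  by move/eqP: Y0; rewrite mulf_eq0 (lt_eqF My) /= sqrf_eq0 => /eqP->.
- by rewrite inner_mx_plane// -[RHS]fXY /bform; ring.
- by rewrite inner_mx_plane// /bform Nx Ny Nxy; ring.
Qed.

Lemma dim3_common_zero {R : realType} {n} {M N : 'M[R]_n} {x y : 'cV[R]_n} :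
  (3 <= n)%N -> M^T = M -> N^T = N ->
  0 < inner (M *m x) x -> inner (M *m y) y < 0 ->
  inner (N *m x) x = 0 -> inner (N *m y) y = 0 ->
  exists u, [/\ u != 0, inner (M *m u) u = 0 & inner (N *m u) u = 0].
Proof.
move=> hn hM hN Mx My Nx Ny.
have [|g0] := eqVneq (inner (N *m x) y) 0.
  exact: polar_zero_common_zero hM hN Mx My Nx Ny.
(* Two linear conditions in dimension at least 3 leave a nonzero [w] polar to [x] and [y] under [N].
   If [N] vanishes at [w], then [w] replaces [x] or [y] according to the sign of [M] at [w]. *)
have [w w0 wN] := exists_orthogonal (row_mx (N *m x) (N *m y)) hn.
move: wN; rewrite mul_mx_row -[0]hsubmxK => /eq_row_mx[wx wy].
have {}wx : inner (N *m x) w = 0 by rewrite innerC innerE wx !mxE.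
have {}wy : inner (N *m y) w = 0 by rewrite innerC innerE wy !mxE.
have [Nw|Nw] := eqVneq (inner (N *m w) w) 0.
  have [Mw|Mw|Mw] := ltgtP (inner (M *m w) w) 0.
  - exact: polar_zero_common_zero hM hN Mx Mw Nx Nw wx.
  - apply: (polar_zero_common_zero hM hN Mw My Nw Ny).
    by rewrite inner_mxC.
  - by exists w; split.
(* The curve below stays in the cone [N = 0] and joins [k *: y] to [x]. *)
pose g := inner (N *m x) y; pose k := - inner (N *m w) w / (2 * g).
(* On the curve, [N] equals [s^2 (1 - s)^2] times [inner (N *m w) w + 2 g k], hence 0. *)
have gk : 2 * g * k = - inner (N *m w) w.
  by rewrite /k mulrC mulfVK// mulf_neq0// pnatr_eq0.
have k0 : k != 0.
  by apply: contraNneq Nw => k0; rewrite -oppr_eq0 -gk k0 mulr0.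
pose c s : 'cV[R]_n :=
    s ^+ 2 *: x + (1 - s) ^+ 2 *: (k *: y) + (s * (1 - s)) *: w.
have cE (A : 'M[R]_n) s : A^T = A -> inner (A *m c s) (c s) =
    s ^+ 4 * inner (A *m x) x + (1 - s) ^+ 4 * k ^+ 2 * inner (A *m y) y +
    s ^+ 2 * (1 - s) ^+ 2 * (inner (A *m w) w + 2 * k * inner (A *m x) y) +
    2 * s ^+ 3 * (1 - s) * inner (A *m x) w +
    2 * k * s * (1 - s) ^+ 3 * inner (A *m y) w.
  move=> hA; rewrite /c !(mulmxDr, innerDl, innerDr) -!scalemxAr.
  rewrite !(innerZl, innerZr) (inner_mxC y x hA) (inner_mxC w x hA).
  by rewrite (inner_mxC w y hA); ring.
pose p : {poly R} := inner (M *m x) x *: 'X ^+ 4 +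
    (k ^+ 2 * inner (M *m y) y) *: (1%:P - 'X) ^+ 4 +
    (inner (M *m w) w + 2 * k * inner (M *m x) y) *:
      ('X ^+ 2 * (1%:P - 'X) ^+ 2) +
    (2 * inner (M *m x) w) *: ('X ^+ 3 * (1%:P - 'X)) +
    (2 * k * inner (M *m y) w) *: ('X * (1%:P - 'X) ^+ 3).
have pE s : p.[s] = inner (M *m c s) (c s).
  by rewrite cE// /p !horner_expand; ring.
have [|s ps] := poly_root01 p.
  (* The end values of [p] are [k^2] times the negative value of [M] at [y], and the positive value
     of [M] at [x]. *)
  rewrite !pE !cE//.
  have -> : forall a b d e f : R, (0 ^+ 4 * a + (1 - 0) ^+ 4 * k ^+ 2 * b +
      0 ^+ 2 * (1 - 0) ^+ 2 * d + 2 * 0 ^+ 3 * (1 - 0) * e +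
      2 * k * 0 * (1 - 0) ^+ 3 * f) * (1 ^+ 4 * a + (1 - 1) ^+ 4 * k ^+ 2 * b +
      1 ^+ 2 * (1 - 1) ^+ 2 * d + 2 * 1 ^+ 3 * (1 - 1) * e +
      2 * k * 1 * (1 - 1) ^+ 3 * f) = k ^+ 2 * (a * b) by move=> *; ring.
  by rewrite mulr_ge0_le0 ?sqr_ge0// mulr_ge0_le0 ?ltW.
exists (c s); split; last 2 first.
- by rewrite -pE.
- by rewrite cE// Nx Ny wx wy -/g (mulrAC 2) gk; ring.
(* Pairing [c s] with [N *m y] and [N *m x] gives [s^2 g] and [(1 - s)^2 k g], which cannot both be
   0. *)
apply/eqP => c0.
have cy : inner (N *m y) (c s) = s ^+ 2 * g.
  rewrite /c !(innerDr, innerZr) Ny wy (inner_mxC y x hN) -/g; ring.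
have cx : inner (N *m x) (c s) = (1 - s) ^+ 2 * (k * g).
  rewrite /c !(innerDr, innerZr) Nx wx -/g; ring.
move/eqP: cy; rewrite c0 inner0r eq_sym mulf_eq0 (negPf g0) orbF sqrf_eq0 => /eqP s0.
move/eqP: cx; rewrite c0 inner0r s0 eq_sym subr0 expr1n mul1r mulf_eq0.
by rewrite (negPf g0) (negPf k0).
Qed.

(** * Surjectivity from a hyperbolic pair *)

Lemma hyperbolic_plane_onto {R : realType} {n} {M N : 'M[R]_n} {x y : 'cV[R]_n} :
  M^T = M -> N^T = N ->
  0 < inner (M *m x) x -> inner (M *m y) y < 0 ->
  inner (N *m x) x = 0 -> inner (N *m y) y = 0 -> inner (N *m x) y != 0 ->
  forall c1 c2, exists u, inner (M *m u) u = c1 /\ inner (N *m u) u = c2.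
Proof.
move=> hM hN Mx My Nx Ny g0 c1 c2.
set p := inner (M *m x) x in Mx; set r := inner (M *m y) y in My.
set g := inner (N *m x) y in g0; pose q := inner (M *m x) y.
pose t := c2 / (2 * g); pose l := c1 - 2 * t * q.
(* At [X x + Y y], [N] is [2 g X Y] and [M] is [p X^2 + 2 q X Y + r Y^2]. *)
suff [X [Y [XY e]]] : exists X Y, X * Y = t /\ p * X ^+ 2 + r * Y ^+ 2 = l.
  exists (X *: x + Y *: y); rewrite !inner_mx_plane// /bform -/p -/r -/g -/q Nx Ny.
  split.
    transitivity ((p * X ^+ 2 + r * Y ^+ 2) + 2 * (X * Y) * q); first ring.
    by rewrite e XY /l; ring.
  transitivity (X * Y * (2 * g)); first ring.
  by rewrite XY /t mulfVK// mulf_neq0// pnatr_eq0.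
clearbody t l; have p0 : p != 0 by rewrite gt_eqF.
have r0 : r != 0 by rewrite lt_eqF.
have [->|t0] := eqVneq t 0.
  have [l0|l0] := leP 0 l.
    exists (Num.sqrt (l / p)), 0; rewrite mulr0 expr0n mulr0 addr0; split=> //.
    have lp : 0 <= l / p by rewrite divr_ge0// ltW.
    by rewrite sqr_sqrtr// mulrC mulfVK.
  exists 0, (Num.sqrt (l / r)); rewrite mul0r expr0n mulr0 add0r; split=> //.
  have lr : 0 <= l / r by rewrite mulr_le0 ?invr_le0 ?ltW.
  by rewrite sqr_sqrtr// mulrC mulfVK.
have t2 : 0 < t ^+ 2 by rewrite exprn_even_gt0.
have pr : 0 < - (p * r) by rewrite -mulrN mulr_gt0// oppr_gt0.
have prt := mulr_gt0 pr t2.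
(* Substituting [Y = t / X] and [a = X^2] gives [p a^2 - l a + r t^2 = 0], with discriminant [D]. As
   [p r < 0], its root [(l + sqrt D) / (2 p)] is positive. *)
pose D := l ^+ 2 - 4 * (p * r) * t ^+ 2.
have D0 : l ^+ 2 < D by rewrite /D; lra.
have sE : Num.sqrt D ^+ 2 = D.
  by rewrite sqr_sqrtr//; apply: ltW; apply: le_lt_trans D0; exact: sqr_ge0.
have ls : `|l| < Num.sqrt D.
  by rewrite -sqrtr_sqr ltr_sqrt//; apply: le_lt_trans D0; exact: sqr_ge0.
move: (Num.sqrt D) sE ls => s sE ls.
have a_gt0 : 0 < (l + s) / (2 * p).
  by rewrite divr_gt0//; [move: ls; rewrite ltr_norml => /andP[]; lra|lra].
have aE : p * ((l + s) / (2 * p)) ^+ 2 + r * t ^+ 2 = l * ((l + s) / (2 * p)).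
  apply/eqP; rewrite -subr_eq0; apply/eqP.
  transitivity ((s ^+ 2 - D) / (4 * p)); first by rewrite /D; field.
  by rewrite sE subrr mul0r.
move: (_ / _) a_gt0 aE => a a_gt0 aE.
have aE' : Num.sqrt a ^+ 2 = a by rewrite sqr_sqrtr ?ltW.
have sa0 : Num.sqrt a != 0 by rewrite gt_eqF// sqrtr_gt0.
exists (Num.sqrt a), (t / Num.sqrt a); split; first by rewrite mulrC mulfVK.
have a0 : a != 0 by rewrite gt_eqF.
rewrite expr_div_n aE'; apply: (mulfI a0); rewrite [RHS]mulrC -aE.
by field.
Qed.

Lemma opposite_pair {R : realType} {n} {A B : 'M[R]_n} {x y : 'cV[R]_n} :
  A^T = A -> B^T = B -> joint_nondegenerate A B ->
  inner (A *m x) x + inner (A *m y) y = 0 ->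
  inner (B *m x) x + inner (B *m y) y = 0 -> ~ (x = 0 /\ y = 0) ->
  (n < 3)%N /\ range (joint_hom A B) = setT.
Proof.
move=> hA hB ND Axy Bxy xy0.
pose P1 := inner (A *m x) x; pose P2 := inner (B *m x) x.
have P_gt0 : 0 < P1 ^+ 2 + P2 ^+ 2.
  apply: sqr_norm_gt0 => -[P10 P20]; apply: xy0; split; first exact: ND.
  by apply: ND; [rewrite -Axy -/P1 P10 add0r|rewrite -Bxy -/P2 P20 add0r].
have P_neq0 : P1 ^+ 2 + P2 ^+ 2 != 0 by rewrite gt_eqF.
(* A similarity of the target taking the value at [x] to the positive first axis, and so the value
   at [y] to the negative one; [inv] undoes it. *)
pose M := P1 *: A + P2 *: B; pose N := P1 *: B - P2 *: A.
have hM : M^T = M by rewrite /M linearD !linearZ/= hA hB.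
have hN : N^T = N by rewrite /N linearB !linearZ/= hA hB.
have ME u : inner (M *m u) u = P1 * inner (A *m u) u + P2 * inner (B *m u) u.
  by rewrite /M mulmxDl -!scalemxAl innerDl !innerZl.
have NE u : inner (N *m u) u = P1 * inner (B *m u) u - P2 * inner (A *m u) u.
  by rewrite /N mulmxBl -!scalemxAl -scaleNr innerDl !innerZl mulNr.
have Ay : inner (A *m y) y = - P1 by rewrite /P1; lra.
have By : inner (B *m y) y = - P2 by rewrite /P2; lra.
have Mx : 0 < inner (M *m x) x by rewrite ME -/P1 -/P2 -!expr2.
have My : inner (M *m y) y < 0 by rewrite ME Ay By; lra.
have Nx : inner (N *m x) x = 0 by rewrite NE -/P1 -/P2; ring.
have Ny : inner (N *m y) y = 0 by rewrite NE Ay By; ring.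
have inv u c1 c2 : inner (M *m u) u = P1 * c1 + P2 * c2 ->
    inner (N *m u) u = P1 * c2 - P2 * c1 ->
    inner (A *m u) u = c1 /\ inner (B *m u) u = c2.
  rewrite ME NE => e1 e2; split; apply: (mulfI P_neq0).
    by have := congr2 (fun a b => P1 * a - P2 * b) e1 e2 => /= e; lra.
  by have := congr2 (fun a b => P2 * a + P1 * b) e1 e2 => /= e; lra.
have no_zero : ~ exists u, [/\ u != 0, inner (M *m u) u = 0 & inner (N *m u) u = 0].
  case=> u [/eqP u0 Mu Nu]; apply: u0.
  by have [] := inv u 0 0; rewrite ?Mu ?Nu ?mulr0 ?addr0 ?subr0//; apply: ND.
split.
  rewrite ltnNge; apply/negP => n3; apply: no_zero.
  exact: dim3_common_zero n3 hM hN Mx My Nx Ny.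
have g0 : inner (N *m x) y != 0.
  apply/eqP => g0; apply: no_zero.
  exact: polar_zero_common_zero hM hN Mx My Nx Ny g0.
apply/seteqP; split=> // -[c1 c2] _.
have [u [Mu Nu]] := hyperbolic_plane_onto hM hN Mx My Nx Ny g0
  (P1 * c1 + P2 * c2) (P1 * c2 - P2 * c1).
by exists u => //; have [] := inv u c1 c2 Mu Nu; rewrite /joint_hom => -> ->.
Qed.

Theorem theorem4p6 (R : realType) (n : nat) (hn : (2 <= n)%N)
    (A B : 'M[R]_n) (a b : 'cV[R]_n)
    (hA : A^T = A) (hB : B^T = B) (hND : joint_nondegenerate A B) :
  (n = 2%N -> range (joint_hom A B) = setT \/ convex2 (range (joint A B a b)))
  /\ ((3 <= n)%N -> convex2 (range (joint A B a b))).
Proof.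
have [no_opp|] := pselect (no_opposite_mx A B).
  by have cvx := joint_range_convex a b hn hA hB no_opp; split=> // _; right.
move=> /existsNP[x /existsNP[y]].
move=> /not_implyP[Axy /not_implyP[Bxy /(opposite_pair hA hB hND Axy Bxy)[n3 onto]]].
by split=> [_|]; [left | rewrite leqNgt n3].
Qed.
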